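(* Let $p$ be an odd prime, $e$ a positive integer, and $n = p^{2e}$. Then the integer $\mathcal{P}_n$ is coprime to $p$.
   Context: For $n \geq 1$ let $F_n(x) = 1 + x + \frac{x^2}{2} + \cdots + \frac{x^n}{n}$, let $L_n = \operatorname{lcm}\{1,2,\dots,n\}$, and let $\widetilde{F}_n(x) = L_n F_n(x) \in \mathbf{Z}[x]$. Note $F_n'(x) = 1 + x + \cdots + x^{n-1}$, whose roots are the $n-1$ nontrivial $n$-th roots of unity. Define $\mathcal{P}_n = \prod_{\theta} \widetilde{F}_n(\theta)$, the product over all $\theta$ with $F_n'(\theta)=0$ (i.e. all $n$-th roots of unity $\theta \neq 1$); this is an integer. *)

(* Defs.v *)
From mathcomp Require Import all_boot all_order all_algebra all_field.

Set Implicit Arguments.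
Unset Strict Implicit.
Unset Printing Implicit Defensive.

Import Order.TTheory GRing.Theory Num.Theory.
Local Open Scope ring_scope.

(* All roots involved are algebraic, so the polynomials are taken over algC. *)
Definition F (n : nat) : {poly algC} :=
  1 + \sum_(1 <= k < n.+1) (k%:R)^-1 *: 'X^k.

Definition L (n : nat) : nat := \big[lcmn/1%N]_(1 <= k < n.+1) k.

Definition Ftilde (n : nat) : {poly algC} := (L n)%:R *: F n.

(* The duplicate-free list of complex roots of a nonzero polynomial. *)
Definition croots (q : {poly algC}) : seq algC :=
  undup (sval (closed_field_poly_normal q)).

Definition P (n : nat) : algC :=
  \prod_(theta <- croots (F n)^`()) (Ftilde n).[theta].

Lemma mem_croots (q : {poly algC}) (x : algC) :
  q != 0 -> (x \in croots q) = root q x.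
Proof.
rewrite /croots mem_undup; case: closed_field_poly_normal => r /= Dq q_neq0.
by rewrite [in RHS]Dq rootZ ?lead_coef_eq0 // root_prod_XsubC.
Qed.

Lemma deriv_F (n : nat) : (F n)^`() = \sum_(0 <= k < n) 'X^k.
Proof.
rewrite /F derivD derivC add0r linear_sum big_add1 /=.
apply: eq_bigr => k _; rewrite derivZ derivXn /= -scaler_nat scalerA.
by rewrite mulVf ?scale1r // pnatr_eq0.
Qed.

Lemma deriv_F_neq0 (n : nat) : (0 < n)%N -> (F n)^`() != 0.
Proof.
move=> n_gt0; apply/eqP => /(congr1 (fun q => q.[1])) /eqP.
rewrite deriv_F horner_sum horner0.
under eq_bigr do rewrite hornerXn expr1n.
by rewrite sumr_const_nat subn0 pnatr_eq0 eqn0Ngt n_gt0.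
Qed.

Lemma mem_croots_deriv_F (n : nat) (x : algC) : (0 < n)%N ->
  (x \in croots (F n)^`()) = (x ^+ n == 1) && (x != 1).
Proof.
move=> n_gt0; rewrite mem_croots ?deriv_F_neq0 // deriv_F /root horner_sum.
under eq_bigr do rewrite hornerXn.
have [->|x_neq1] := eqVneq x 1.
  under eq_bigr do rewrite expr1n.
  by rewrite sumr_const_nat subn0 pnatr_eq0 andbF eqn0Ngt n_gt0.
rewrite andbT -[x ^+ n == 1]subr_eq0 subrX1 mulf_eq0 subr_eq0 (negPf x_neq1).
by rewrite big_mkord.
Qed.

Lemma Ftilde_int (n : nat) : Ftilde n \is a polyOver Num.int.
Proof.
apply/polyOverP => i; rewrite coefZ coefD coef1 coef_sum mulrDr rpredD //.
  by rewrite rpredM ?rpred_nat.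
rewrite mulr_sumr big_nat rpred_sum // => k /andP[k_gt0 k_le].
rewrite coefZ coefXn mulrA rpredM ?rpred_nat //.
have /dvdnP[d ->]: (k %| L n)%N.
  by rewrite /L (big_rem k) ?mem_index_iota ?k_gt0 //= dvdn_lcml.
by rewrite natrM mulfK ?rpred_nat // pnatr_eq0 -lt0n.
Qed.

(* Main.v *)
(** Every coefficient [L n / k] of [Ftilde n] with [k < n], and the constant
    coefficient [L n], is divisible by [p] when [n] is a power of [p], while
    [c = L n / n] is not: hence [Ftilde n] is congruent to [c X^n] modulo [p].
    If [A] is an integer matrix with characteristic polynomial
    [1 + X + ... + X^(n-1)], then [P n] is the determinant of [Ftilde n]
    evaluated at [A], which modulo [p] is the determinant of [c A^n]; this is a
    unit since [A] has determinant [1] or [-1]. *)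
Require Import Defs.
From mathcomp Require Import all_boot all_order all_algebra all_field.
Import Order.TTheory GRing.Theory Num.Theory.
Local Open Scope ring_scope.

(** The companion matrix of [q] works. The size [N.+2] makes the dimension a visible successor, as
    [horner_mx] requires. *)
Lemma monic_char_poly (R : comNzRingType) (N : nat) (q : {poly R}) :
  q \is monic -> size q = N.+2 -> exists A : 'M[R]_N.+1, char_poly A = q.
Proof.
move=> q_monic sz_q; have := companionmxK q_monic.
by move: (companionmx q); rewrite sz_q => A char_A; exists A.
Qed.

(** Both sides are multiplicative in [g], so splitting [g] into linear factors reduces the claim to
    [g = 'X - y%:P], where the determinant is a value of the characteristic polynomial up to sign.
    No triangular form of [A] is needed. *)
Lemma det_horner_mx_roots (K : closedFieldType) (N : nat) (A : 'M[K]_N.+1)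
    (r : seq K) (g : {poly K}) :
  char_poly A = \prod_(x <- r) ('X - x%:P) ->
  \det (horner_mx A g) = \prod_(x <- r) g.[x].
Proof.
move=> char_A.
have size_r : size r = N.+1.
  by apply: succn_inj; rewrite -(size_prod_XsubC r id) -char_A size_char_poly.
have const_r (a : K) : \prod_(x <- r) a = a ^+ size r.
  by rewrite big_const_seq count_predT -Monoid.iteropE.
have det_XsubC y : \det (horner_mx A ('X - y%:P)) = \prod_(x <- r) (x - y).
  rewrite rmorphB /= horner_mx_X horner_mx_C -opprB -scaleN1r detZ.
  have -> : y%:M - A = map_mx (horner_eval y) (char_poly_mx A).
    by apply/matrixP => i j; rewrite !mxE /= /horner_eval hornerD hornerN hornerC
      hornerMn hornerX.
  rewrite det_map_mx -/(char_poly A) char_A /= /horner_eval horner_prod -size_r.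
  (* The sign [(-1) ^+ N.+1] is spread over the [N.+1] factors, turning each [y - x] into
     [x - y]. *)
  rewrite -const_r -big_split /=; apply: eq_bigr => x _.
  by rewrite hornerXsubC mulN1r opprB.
have [s ->] := closed_field_poly_normal g.
under [RHS]eq_bigr do rewrite hornerZ horner_prod.
rewrite big_split /= const_r size_r linearZ /= detZ; congr (_ * _).
rewrite exchange_big /=; elim: s => [|y s IHs].
  by rewrite !big_nil rmorph1 det1.
rewrite !big_cons rmorphM /= det_mulmx IHs det_XsubC; congr (_ * _).
by apply: eq_bigr => x _; rewrite hornerXsubC.
Qed.

(** Separability makes the root list duplicate-free already, so [undup] loses no multiplicity. *)
Lemma prod_croots (q : {poly algC}) :
  q \is monic -> separable_poly q ->
  q = \prod_(x <- croots q) ('X - x%:P).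
Proof.
rewrite /croots; case: closed_field_poly_normal => r /= Dq /monicP lead_q.
by rewrite {1 2}Dq lead_q scale1r separable_prod_XsubC => /undup_id->.
Qed.

Lemma size_sum_Xn (R : nzRingType) (n : nat) :
  size (\sum_(0 <= k < n) 'X^k : {poly R}) = n.
Proof.
elim: n => [|n IHn]; first by rewrite big_geq ?size_poly0.
by rewrite big_nat_recr //= addrC size_polyDl size_polyXn ?IHn.
Qed.

Lemma monic_sum_Xn (R : nzRingType) (n : nat) :
  (0 < n)%N -> (\sum_(0 <= k < n) 'X^k : {poly R}) \is monic.
Proof.
case: n => // n _; rewrite monicE big_nat_recr //= addrC.
by rewrite lead_coefDl ?lead_coefXn // size_polyXn size_sum_Xn.
Qed.

Lemma separable_sum_Xn (K : fieldType) (n : nat) :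
  n%:R != 0 :> K -> separable_poly (\sum_(0 <= k < n) 'X^k : {poly K}).
Proof.
move=> /separable_Xn_sub_1; apply: dvdp_separable.
by rewrite subrX1 big_mkord dvdp_mull.
Qed.

(** An integral model of [Ftilde], to be mapped both to [algC] and to ['F_p]; the divisions are
    exact. *)
Definition intFtilde (n : nat) : {poly int} :=
  (L n)%:R + \sum_(1 <= k < n.+1) (L n %/ k)%:R *: 'X^k.

Lemma map_intFtilde (R : nzRingType) (n : nat) :
  map_poly intr (intFtilde n) =
    (L n)%:R + \sum_(1 <= k < n.+1) (L n %/ k)%:R *: 'X^k :> {poly R}.
Proof.
rewrite rmorphD rmorph_nat rmorph_sum /=; congr (_ + _).
by apply: eq_bigr => k _; rewrite map_polyZ map_polyXn rmorph_nat.
Qed.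

Lemma dvdn_L (n k : nat) : (0 < k <= n)%N -> (k %| L n)%N.
Proof.
by move=> k_n; rewrite /L (big_rem k) ?mem_index_iota //= dvdn_lcml.
Qed.

Lemma map_intFtilde_algC (n : nat) : map_poly intr (intFtilde n) = Ftilde n.
Proof.
rewrite map_intFtilde /Ftilde /F scalerDr alg_polyC rmorph_nat; congr (_ + _).
rewrite scaler_sumr; apply: eq_big_nat => k /andP[k_gt0 k_le].
rewrite scalerA; congr (_ *: _).
have /dvdnP[d ->] : (k %| L n)%N by rewrite dvdn_L ?k_gt0.
by rewrite mulnK // natrM mulfK // pnatr_eq0 -lt0n.
Qed.

(** The valuation of an lcm is the maximum of the valuations, and [p ^ logn p k] divides
    [k <= p ^ m]. Positivity joins the invariant because [logn_lcm] needs it. *)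
Lemma logn_L (p m : nat) : prime p -> (logn p (L (p ^ m)) <= m)%N.
Proof.
move=> p_pr.
suff /andP[] : (0 < L (p ^ m))%N && (logn p (L (p ^ m)) <= m)%N by [].
rewrite /L big_nat_cond.
apply: (big_ind (fun x => (0 < x)%N && (logn p x <= m)%N)).
- by rewrite logn1.
- move=> x y /andP[x_gt0 x_le] /andP[y_gt0 y_le].
  by rewrite lcmn_gt0 x_gt0 y_gt0 logn_lcm // geq_max x_le.
move=> k; rewrite andbT => /andP[k_gt0 k_le]; rewrite k_gt0 /=.
rewrite -(leq_exp2l _ _ (prime_gt1 p_pr)) -ltnS (leq_trans _ k_le) //.
by rewrite ltnS dvdn_leq ?pfactor_dvdnn.
Qed.

Lemma L_gt0 (n : nat) : (0 < L n)%N.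
Proof.
rewrite /L big_nat_cond; apply: (big_ind (fun x => 0 < x)%N) => //.
  by move=> x y x_gt0 y_gt0; rewrite lcmn_gt0 x_gt0.
by move=> k /andP[/andP[]].
Qed.

Lemma dvdn_L_div (p m k : nat) :
  prime p -> (0 < k < p ^ m)%N -> (p %| L (p ^ m) %/ k)%N.
Proof.
move=> p_pr /andP[k_gt0 k_lt]; apply: contraLR (k_lt) => p_ndvd.
have pm_gt0 : (0 < p ^ m)%N by rewrite expn_gt0 prime_gt0.
(* If [p] does not divide the quotient, then [p ^ m], which divides [L (p ^ m) %/ k * k], must
   divide [k]. *)
rewrite -leqNgt dvdn_leq // -(@Gauss_dvdr _ (L (p ^ m) %/ k)).
  by rewrite divnK dvdn_L ?pm_gt0 ?leqnn ?k_gt0 // ltnW.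
by rewrite coprimeXl // prime_coprime.
Qed.

Lemma ndvdn_L_div (p m : nat) : prime p -> ~~ (p %| L (p ^ m) %/ p ^ m)%N.
Proof.
move=> p_pr; have pm_gt0 : (0 < p ^ m)%N by rewrite expn_gt0 prime_gt0.
rewrite dvdn_divRL; last by rewrite dvdn_L ?pm_gt0 ?leqnn.
rewrite -expnS pfactor_dvdn ?L_gt0 //.
by rewrite -leqNgt logn_L.
Qed.

Lemma map_intFtilde_Fp (p m : nat) : prime p -> (0 < m)%N ->
  map_poly intr (intFtilde (p ^ m)) =
    (L (p ^ m) %/ p ^ m)%:R *: 'X^(p ^ m) :> {poly 'F_p}.
Proof.
move=> p_pr m_gt0; set n := (p ^ m)%N.
have n_gt0 : (0 < n)%N by rewrite expn_gt0 prime_gt0.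
have dvd0 d : (p %| d)%N -> d%:R = 0 :> 'F_p.
  by rewrite (dvdn_pcharf (pchar_Fp p_pr)) => /eqP.
rewrite map_intFtilde big_nat_recr //= big_nat big1 => [|k k_lt].
  have dvd_L : (p %| L n)%N.
    have n_dvd : (n %| L n)%N by rewrite dvdn_L ?n_gt0 ?leqnn.
    by rewrite (dvdn_trans _ n_dvd) ?dvdn_exp.
  by rewrite -polyC_natr dvd0 // polyC0 !add0r.
by rewrite dvd0 ?scale0r // dvdn_L_div.
Qed.

Theorem theorem1p2 (p e n : nat) (p_prime : prime p) (p_odd : odd p)
    (e_gt0 : (0 < e)%N) (hn : n = (p ^ (2 * e))%N) :
  exists m : int, P n = m%:~R /\ coprimez m p%:Z.
Proof.
have e2_gt0 : (0 < 2 * e)%N by rewrite muln_gt0.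
have n_gt1 : (1 < n)%N by rewrite hn -(expn0 p) ltn_exp2l ?prime_gt1.
have n_gt0 := ltnW n_gt1.
(* The degree [n - 1] is the matrix dimension [N.+1]. *)
have [N Dn] : exists N, n = N.+2 by case: (n) n_gt1 => [|[|N]] // _; exists N.
have [A char_A] := @monic_char_poly _ N _ (monic_sum_Xn int n n_gt0)
  (etrans (size_sum_Xn int n) Dn).
have map_char_A (R : nzRingType) :
    char_poly (map_mx intr A : 'M[R]_N.+1) = \sum_(0 <= k < n) 'X^k.
  rewrite -map_char_poly char_A rmorph_sum /=.
  by apply: eq_bigr => k _; rewrite map_polyXn.
exists (\det (horner_mx A (intFtilde n))); split.
  rewrite -det_map_mx map_horner_mx map_intFtilde_algC /P deriv_F.
  rewrite (@det_horner_mx_roots _ _ _ (croots (\sum_(0 <= k < n) 'X^k))) //.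
  rewrite map_char_A -prod_croots ?monic_sum_Xn //.
  by rewrite separable_sum_Xn // pnatr_eq0 -lt0n.
have pcharFp := pchar_Fp p_prime.
rewrite coprimez_sym coprimezE absz_nat prime_coprime //.
rewrite -[X in ~~ X]/((p %| _)%Z) (dvdz_pcharf pcharFp).
rewrite -det_map_mx map_horner_mx hn map_intFtilde_Fp // -hn.
rewrite linearZ rmorphXn /= horner_mx_X detZ mulf_neq0 //.
  rewrite expf_neq0 // -(dvdn_pcharf pcharFp) hn ndvdn_L_div //.
(* Up to sign, this determinant is the constant coefficient of the characteristic polynomial, which
   is 1. *)
have det_A : \det (map_mx intr A : 'M['F_p]_N.+1) != 0.
  have := char_poly_det (map_mx intr A : 'M['F_p]_N.+1).
  rewrite map_char_A coef_sum big_ltn // big_nat big1 => [|k /andP[k_gt0 _]].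
    rewrite coefXn addr0 => /esym/eqP; apply: contraTneq => ->.
    by rewrite mulr0 eq_sym oner_eq0.
  by rewrite coefXn eq_sym gtn_eqF.
have det_X k : \det (map_mx intr A ^+ k : 'M['F_p]_N.+1) =
    \det (map_mx intr A : 'M['F_p]_N.+1) ^+ k.
  by elim: k => [|k IHk]; rewrite ?det1 // !exprS det_mulmx IHk.
by rewrite det_X expf_neq0.
Qed.
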